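(* Let $k\ge3$ be an integer, $p$ a prime and $d\ge1$ with $q=p^d>\left(\tfrac12k(k-1)\right)^{k(k-1)}$ and $q\equiv k(k-1)+1\pmod{2k(k-1)}$. Let $H_0$ be the subgroup of order $(q-1)/(k(k-1))$ of ${\rm GF}(q)^\times$ and $G=\{x\mapsto ax+b: a\in H_0,\ b\in{\rm GF}(q)\}$, a nonabelian subgroup of the affine group of ${\rm GF}(q)$ isomorphic to $({\rm GF}(q),+)\rtimes C_{(q-1)/(k(k-1))}$. Then $G$ contains a regular \[\left(\frac{q(q-1)}{k(k-1)},\ \frac{k(q-k)}{k-1},\ \frac{q-1}{k-1}+(k-1)^2-2,\ k^2\right)\text{-PDS}.\]
   Context: A $(v,k',\lambda,\mu)$-PDS in a group $G$ of order $v$ is a $k'$-subset $D$ such that every nonidentity element of $D$ is $xy^{-1}$ ($x,y\in D$) in exactly $\lambda$ ways and every nonidentity element of $G\setminus D$ in exactly $\mu$ ways; regular means $D=D^{(-1)}$ and $1\notin D$. *)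

(* Defs.v *)
From HB Require Import structures.
From mathcomp Require Import all_boot all_order all_algebra all_fingroup all_field.
Set Implicit Arguments. Unset Strict Implicit. Unset Printing Implicit Defensive.

Local Open Scope group_scope.

Definition is_PDS (gT : finGroupType) (G D : {set gT}) (v k' lam mu : nat) : Prop :=
  [/\ D \subset G, #|G| = v, #|D| = k' &
      forall g, g \in G -> g != 1 ->
        #|[set xy in setX D D | xy.1 * xy.2^-1 == g]| = (if g \in D then lam else mu)].

Definition is_regular_PDS (gT : finGroupType) (G D : {set gT}) (v k' lam mu : nat) : Prop :=
  [/\ is_PDS G D v k' lam mu, D^-1 = D & 1 \notin D].

Definition affine_group (F : finFieldType) (H0 : {set {unit F}}) : {set {perm F}} :=
  [set s : {perm F} | [exists u in H0, exists b : F, [forall x : F, s x == (val u * x + b)%R]]].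

(* Main.v *)
Require Import Defs.
From HB Require Import structures.
From mathcomp Require Import all_boot all_order all_algebra all_fingroup all_field.
From mathcomp Require Import all_solvable zify ring.
Set Implicit Arguments. Unset Strict Implicit. Unset Printing Implicit Defensive.
Import Order.TTheory GRing.Theory Num.Theory.

(** Write [q - 1 = K t] with [K = k (k - 1)]; the congruence says that [t = |H0|]
    is odd.  If [B] is a [k]-subset of GF(q) whose [K] differences lie in distinct
    cosets of [H0], then the translates [h(B)], [h] in [G], form a Steiner system
    2-(q, k, 1) on whose blocks [G] acts regularly.  Two points lie in one common
    block and a point lies in [r = (q - 1) / (k - 1)] blocks, so for [g] in [G]
    [sum_h |hB & B| |hB & gB| = k ^ 2 + (r - 1) |B & gB|].  Dropping the terms
    [h = 1, g] shows that the [g <> 1] with [gB] meeting [B] form the required PDS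
    (its Cayley graph is the block graph of the Steiner system).

    To find [B], let [e = K / 2].  As [t] is odd, [x] and [- x] lie in different
    cosets of [H0], so it is enough that the [b_j - b_i] with [i < j] lie in distinct
    cosets of the subgroup of index [e], that is, that their powers of exponent
    [f = 2 t] are the [e] distinct [e]-th roots of unity.  The [b_i] are chosen one at
    a time, keeping large sets of candidates for the later ones; a second moment
    estimate for the cyclotomic classes replaces the Weil bound. *)

(** * Moments of cyclotomic class counts over translates *)

Section CyclotomicVariance.
Local Open Scope ring_scope.
Variables (F : finFieldType) (f e : nat).
Hypothesis fe : (f * e)%N = #|F|.-1.

Lemma card_unity_roots (n : nat) : (0 < n)%N -> (#|[set x : F | x ^+ n == 1%R]| <= n)%N.
Proof.
move=> n0; rewrite cardE; apply: (max_unity_roots n0); last exact: enum_uniq.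
by apply/allP => x; rewrite mem_enum inE => /eqP xn; apply/unity_rootP.
Qed.

Let q1 : (1 < #|F|)%N := finNzRing_gt1 F.

Let f_gt0 : (0 < f)%N. Proof. by move: fe q1; case: f => [|//]; lia. Qed.
Let e_gt0 : (0 < e)%N. Proof. by move: fe q1; case: e => [|//]; lia. Qed.

(** For [g ^+ e = 1] the solutions of [x ^+ f = g] form a coset of the subgroup of order [f], so
    this counts the points of [S] in a cyclotomic class translated by [z]. *)
Definition translate_count (S : {set F}) (g z : F) : nat :=
  #|[set x in S | (x - z) ^+ f == g]|.

Lemma translate_countE S g z :
  translate_count S g z = (\sum_(x in S) ((x - z)%R ^+ f == g))%N.
Proof.
by rewrite /translate_count -sum1_card big_mkcond [RHS]big_mkcond /=;
  apply: eq_bigr => x _; rewrite inE; case: (x \in S); case: eqP.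
Qed.

Lemma expf_card1 (x : F) : x != 0 -> x ^+ #|F|.-1 = 1.
Proof.
move=> x0; apply: (mulIf x0); rewrite mul1r -exprSr prednK ?expf_card //.
exact: ltnW.
Qed.

Lemma expfe1 (x : F) : x != 0 -> (x ^+ f) ^+ e = 1.
Proof. by move=> x0; rewrite -exprM fe expf_card1. Qed.

(** A nonzero [a] lies in exactly one class, that of [a ^+ f], and 0 in none; this collapses the sum
    over classes in both moments. *)
Lemma sum_class_indicator (a : F) (P : pred F) :
  (\sum_(g : F | g ^+ e == 1%R) (a ^+ f == g) * P g)%N = ((a != 0%R) * P (a ^+ f))%N.
Proof.
have [->|a0] := eqVneq a 0.
  rewrite big1 // => g /eqP ge; rewrite expr0n; move: f_gt0; case: f => // n _ /=.
  case: eqP => // eg; move/eqP: ge; rewrite -eg expr0n; move: e_gt0; case: e => //= m _.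
  by rewrite eq_sym oner_eq0.
rewrite (bigD1 (a ^+ f)) /=; last by rewrite expfe1.
by rewrite eqxx big1 ?addn0 // => g /andP[_]; rewrite eq_sym => /negbTE->.
Qed.

Lemma sum_translate_count (S : {set F}) :
  (\sum_(g : F | g ^+ e == 1%R) \sum_(z : F) translate_count S g z
   = #|S| * #|F|.-1)%N.
Proof.
under eq_bigr => g _ do under eq_bigr => z _ do rewrite translate_countE.
under eq_bigr => g _ do rewrite exchange_big /=.
rewrite exchange_big /= -sum_nat_const; apply: eq_bigr => x _.
rewrite exchange_big /= -(cardC1 x) -sum1_card [RHS]big_mkcond /=.
apply: eq_bigr => z _.
have := sum_class_indicator (x - z) predT; rewrite /= subr_eq0 muln1 eq_sym.
under eq_bigr => g _ do rewrite muln1.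
by move->; rewrite inE; case: eqP.
Qed.

(* [u = (y - z) / (x - z)] runs over [F \ {1}] as [z] runs over [F \ {x}]. *)
Lemma card_equal_class (x y : F) : x != y ->
  (#|[set z | (x != z) && ((y - z)%R ^+ f == (x - z)%R ^+ f)]| <= f.-1)%N.
Proof.
move=> xy; set A := [set _ | _].
have injA : {in A &, injective (fun z => (y - z) / (x - z))}.
  move=> z w; rewrite !inE => /andP[xz _] /andP[xw _] /eqP.
  have := subr_eq0 x z; have := subr_eq0 x w.
  rewrite (negbTE xz) (negbTE xw) => /negbT xw0 /negbT xz0.
  rewrite eqr_div // -subr_eq0.
  have -> : (y - z) * (x - w) - (y - w) * (x - z) = (y - x) * (z - w) by ring.
  by rewrite mulf_eq0 !subr_eq0 eq_sym (negbTE xy) => /eqP.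
rewrite -(card_in_imset injA) -ltnS prednK //.
apply: leq_trans (card_unity_roots f_gt0).
rewrite (cardsD1 1 [set _ | _]) inE expr1n eqxx add1n ltnS; apply: subset_leq_card.
apply/subsetP => u /imsetP[z]; rewrite !inE => /andP[xz /eqP E] ->.
have xz0 : x - z != 0 by rewrite subr_eq0.
rewrite expr_div_n E divff ?expf_neq0 // eqxx andbT.
apply: contra xy => /eqP E1; have : y - z = x - z.
  by rewrite -[LHS](divfK xz0) E1 mul1r.
by move/addIr->.
Qed.

(** Expanding the square counts the [z] that put [x - z] and [y - z] in the same class: [#|F|.-1] of
    them when [x = y], at most [f.-1] otherwise. *)
Lemma sum_translate_count_sq (S : {set F}) :
  (\sum_(g : F | g ^+ e == 1%R) \sum_(z : F) translate_count S g z ^ 2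
   <= #|S| * (#|F|.-1 + #|S|.-1 * f.-1))%N.
Proof.
have -> : (\sum_(g : F | g ^+ e == 1%R) \sum_(z : F) translate_count S g z ^ 2
  = \sum_(x in S) \sum_(y in S) #|[set z | (x != z) && ((y - z)%R ^+ f == (x - z)%R ^+ f)]|)%N.
  under [LHS]eq_bigr => g _ do under eq_bigr => z _ do
    rewrite translate_countE -mulnn big_distrlr /=.
  under eq_bigr => g _ do rewrite exchange_big /=.
  rewrite exchange_big /=; apply: eq_bigr => x _.
  under eq_bigr => g _ do rewrite exchange_big /=.
  rewrite exchange_big /=; apply: eq_bigr => y _.
  rewrite exchange_big /= -sum1_card [RHS]big_mkcond /=; apply: eq_bigr => z _.
  rewrite (sum_class_indicator (x - z) (fun g => (y - z) ^+ f == g)) subr_eq0 inE.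
  by case: (x == z); case: eqP.
rewrite -sum_nat_const; apply: leq_sum => x xS.
rewrite (bigD1 x) //= leq_add //.
  rewrite -(cardC1 x); apply: subset_leq_card; apply/subsetP => z.
  by rewrite !inE eq_sym => /andP[].
have -> : #|S|.-1 = #|[pred y in S | y != x]|.
  rewrite (cardsD1 x) xS add1n /=; apply: eq_card => y; rewrite !inE.
  by rewrite andbC.
rewrite -sum_nat_const.
by apply: leq_sum => y /andP[_ yx]; apply: card_equal_class; rewrite eq_sym.
Qed.

(** The mean [f * #|S| / #|F|] is scaled by [#|F|] to stay in the integers. The variances of all
    classes are added, so that the two moments apply, and the one for [g] is at most their sum. *)
Lemma translate_count_variance (S : {set F}) (g : F) : g ^+ e = 1 ->
  \sum_(z : F) (#|F|%:R * (translate_count S g z)%:R - f%:R * #|S|%:R) ^+ 2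
  <= #|F|%:R * (#|F|%:R - f%:R) * #|S|%:R * (#|F|%:R - #|S|%:R) :> int.
Proof.
move=> ge.
set q : int := #|F|%:R; set s : int := #|S|%:R; set a : int := f%:R.
set V := fun g => \sum_(z : F) (q * (translate_count S g z)%:R - a * s) ^+ 2.
have V0 h : 0 <= V h by apply: sumr_ge0 => z _; exact: sqr_ge0.
apply: (@le_trans _ _ (\sum_(h : F | h ^+ e == 1) V h)).
  rewrite [leRHS](bigD1 g) /=; last by rewrite ge.
  by rewrite lerDl sumr_ge0.
have -> : \sum_(h : F | h ^+ e == 1) V h =
   q ^+ 2 * (\sum_(h : F | h ^+ e == 1%R) \sum_(z : F) translate_count S h z ^ 2)%N%:R
   - 2 * q * a * s * (\sum_(h : F | h ^+ e == 1%R) \sum_(z : F) translate_count S h z)%N%:R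
   + #|[set h : F | h ^+ e == 1]|%:R * q * (a * s) ^+ 2.
  have -> : #|[set h : F | h ^+ e == 1]|%:R * q * (a * s) ^+ 2 =
      \sum_(h : F | h ^+ e == 1) \sum_(z : F) (a * s) ^+ 2.
    rewrite [RHS](eq_bigl [in [set h : F | h ^+ e == 1]]); last by move=> h; rewrite !inE.
    by rewrite !sumr_const -mulrA /q !mulr_natl.
  rewrite !natr_sum !mulr_sumr -sumrN -!big_split /=; apply: eq_bigr => h _.
  rewrite !natr_sum !mulr_sumr -sumrN -!big_split /=; apply: eq_bigr => z _.
  by rewrite natrX; ring.
rewrite sum_translate_count.
have le2 := sum_translate_count_sq S.
have lee := card_unity_roots e_gt0.
have q0 : 0 <= q by [].
have qfe : q = a * e%:R + 1.
  by rewrite /q /a -natrM fe natr1 (ltn_predK q1).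
have -> : (#|S| * #|F|.-1)%:R = s * (q - 1) :> int.
  by rewrite natrM qfe addrK /a -[f%:R * _]natrM fe.
(* The second moment and the number of classes give way to their upper bounds; as [a * e = q - 1],
   the result factors as claimed. *)
apply: (@le_trans _ _ (q ^+ 2 * (s * ((q - 1) + (s - 1) * (a - 1)))
   - 2 * q * a * s * (s * (q - 1)) + e%:R * q * (a * s) ^+ 2)); last first.
  have ae : a * e%:R = q - 1 by rewrite qfe addrK.
  have -> : e%:R * q * (a * s) ^+ 2 = (a * e%:R) * q * a * s ^+ 2 by ring.
  by rewrite ae le_eqVlt; apply/orP; left; apply/eqP; ring.
apply: lerD; last by rewrite !ler_wpM2r ?ler_nat ?sqr_ge0.
rewrite lerD2r ler_wpM2l ?sqr_ge0 //.
have [s0|s_gt0] := posnP #|S|.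
  by move: le2; rewrite /s s0 mul0n leqn0 => /eqP->; rewrite mul0r.
have -> : s * (q - 1 + (s - 1) * (a - 1)) = (#|S| * (#|F|.-1 + #|S|.-1 * f.-1))%N%:R.
  rewrite natrM natrD natrM /s /q /a; move: s_gt0 f_gt0 q1.
  case: #|S| => // n _; case: (f) => // m _; case: #|F| => // l _.
  by rewrite -!natr1 /=; ring.
by rewrite ler_nat.
Qed.


(** * Selecting points with prescribed difference classes *)

Lemma exists_pair_in_class (S0 S1 : {set F}) (g : F) : g ^+ e = 1 ->
  (#|F| * e ^ 2 < #|S0| * #|S1|)%N ->
  exists x y, [/\ x \in S0, y \in S1 & (y - x) ^+ f = g].
Proof.
move=> ge big.
have [/existsP[x /existsP[y /and3P[? ? /eqP ?]]]|no] :=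
  boolP [exists x, exists y, [&& x \in S0, y \in S1 & (y - x) ^+ f == g]].
  by exists x, y.
have N0 x : x \in S0 -> translate_count S1 g x = 0%N.
  move=> xS; apply/eqP; rewrite cards_eq0; apply/eqP/setP => y; rewrite !inE.
  apply/negP => /andP[yS yx]; case/negP: no; apply/existsP; exists x.
  by apply/existsP; exists y; rewrite xS yS yx.
have := translate_count_variance S1 ge.
set V := \sum_z _.
(* Every point of [S0] has count 0, so it deviates by the full mean. *)
have : #|S0|%:R * (f%:R * #|S1|%:R) ^+ 2 <= V :> int.
  rewrite /V (bigID [in S0]) /= -[leLHS]addr0 lerD ?sumr_ge0 // => [|z _]; last exact: sqr_ge0.
  under eq_bigr => x xS do rewrite (N0 x xS) mulr0 sub0r sqrrN.
  by rewrite sumr_const mulr_natl.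
move: big (max_card S1) fe f_gt0 e_gt0 q1.
move: #|F| #|S1| #|S0| => q s1 s0 big s1q fe' f0 e0 q1' /le_trans H /H {H}.
have qfe : (f * e).+1 = q by rewrite fe' (ltn_predK q1').
have fq : (f <= q)%N by rewrite -qfe ltnW // ltnS leq_pmulr.
have s10 : (0 < s1)%N by case: s1 big {s1q} => //; rewrite muln0.
(* Both [q - f] and [q - s1] are at most [q - 1 = f * e]; then [s1 * f ^ 2] cancels. *)
have : (q%:R * (q%:R - f%:R) * s1%:R * (q%:R - s1%:R) <=
  q%:R * (f%:R * e%:R) * s1%:R * (f%:R * e%:R) :> int).
  have -> : f%:R * e%:R = q%:R - 1 :> int by rewrite -qfe -natrM -natr1 addrK.
  have q11 : (1 <= q%:R :> int) by rewrite (ler_nat _ 1) ltnW.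
  apply: ler_pM; rewrite ?mulr_ge0 ?subr_ge0 ?ler_nat //; last first.
    by rewrite lerD2l lerN2 (ler_nat _ 1).
  by rewrite ler_wpM2r // ler_wpM2l // lerD2l lerN2 (ler_nat _ 1).
move=> H1 /le_trans/(_ H1).
have -> : s0%:R * (f%:R * s1%:R) ^+ 2 = (s1 * f ^ 2)%N%:R * (s0 * s1)%N%:R :> int.
  by rewrite !natrM ?natrX; ring.
have -> : q%:R * (f%:R * e%:R) * s1%:R * (f%:R * e%:R)
    = (s1 * f ^ 2)%N%:R * (q * e ^ 2)%N%:R :> int.
  by rewrite !natrM ?natrX; ring.
rewrite ler_pM2l ?ltr0n ?muln_gt0 ?s10 ?expn_gt0 ?f0 // ler_nat => H2.
by move: big; rewrite ltnNge H2.
Qed.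

(** Chebyshev's inequality: the mean is about [#|S| / e], so a count below [#|S| / e ^ 2] misses it
    by at least [#|S| / (2 * e)]. *)
Lemma card_poor_translates (S : {set F}) (g : F) : g ^+ e = 1 ->
  (3 <= e)%N -> (6 <= #|F|)%N ->
  (#|[set z : F | e ^ 2 * translate_count S g z < #|S|]| * #|S| <= 4 * e ^ 2 * #|F|)%N.
Proof.
move=> ge e3 q6; set A := [set z | _].
have qfe : (f * e).+1 = #|F| by rewrite fe (ltn_predK q1).
have := translate_count_variance S ge.
set V := \sum_z _.
have : #|A|%:R * (#|S|%:R * #|F|%:R) ^+ 2 <= (2 * e%:R) ^+ 2 * V :> int.
  rewrite /V (bigID [in A]) /= mulrDr -[leLHS]addr0 lerD //; last first.
    by rewrite mulr_ge0 ?sqr_ge0 // sumr_ge0 // => z _; exact: sqr_ge0.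
  rewrite mulr_sumr mulr_natl -sumr_const; apply: ler_sum => z.
  rewrite inE -exprMn => zA; rewrite -[leRHS]sqrrN.
  rewrite -mulrN opprB.
  have : #|S|%:R * #|F|%:R <= 2 * e%:R * (f%:R * #|S|%:R - #|F|%:R * (translate_count S g z)%:R) :> int.
    move: zA qfe; move: #|F| q6 #|S| (translate_count S g z) => q q6' s N zA qfe.
    have e0 : 0 < (e%:R : int) by rewrite ltr0n.
    rewrite -(ler_pM2l e0) mulrBr mulrBr.
    have -> : e%:R * (2 * e%:R * (f%:R * s%:R)) = (2 * e * s * (f * e))%N%:R :> int.
      by rewrite !natrM; ring.
    have -> : e%:R * (2 * e%:R * (q%:R * N%:R)) = (2 * q * (e ^ 2 * N))%N%:R :> int.
      by rewrite !natrM ?natrX; ring.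
    rewrite -!natrM lerBrDr -natrD ler_nat.
    apply: (@leq_trans (e * (s * q) + 2 * q * s)).
      by rewrite leq_add2l leq_mul2l ltnW ?orbT.
    have -> : (f * e)%N = q.-1 by rewrite -qfe.
    clear -e3 q6'; move: e e3 => c c3.
    (* Equivalent to [2 * c <= (c - 2) * q], which holds for [c >= 3] and [q >= 6]. *)
    have : (c * q + 2 * q <= 2 * c * q.-1)%N by nia.
    by move/(leq_mul (leqnn s)); lia.
  move=> H; have H0 : 0 <= #|S|%:R * #|F|%:R :> int by rewrite mulr_ge0.
  by rewrite ler_sqr ?nnegrE //; exact: le_trans H.
move=> /le_trans H H'.
have {H} /H : (2 * e%:R) ^+ 2 * V <= (2 * e%:R) ^+ 2 * (#|F|%:R ^+ 3 * #|S|%:R).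
  rewrite ler_wpM2l ?sqr_ge0 //; apply: le_trans H' _.
  have sq := max_card S.
  have fq : (f <= #|F|)%N by rewrite -qfe ltnW // ltnS leq_pmulr.
  have -> : #|F|%:R ^+ 3 * #|S|%:R = #|F|%:R * #|F|%:R * #|S|%:R * #|F|%:R :> int by ring.
  apply: ler_pM; rewrite ?mulr_ge0 ?subr_ge0 ?ler_nat ?gerBl //.
  by rewrite ler_wpM2r // ler_wpM2l // gerBl.
have [->|s0] := posnP #|S|; first by rewrite muln0.
have -> : #|A|%:R * (#|S|%:R * #|F|%:R) ^+ 2 =
    (#|S| * #|F| ^ 2)%N%:R * (#|A| * #|S|)%N%:R :> int.
  by rewrite !natrM ?natrX; ring.
have -> : (2 * e%:R) ^+ 2 * (#|F|%:R ^+ 3 * #|S|%:R) =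
    (#|S| * #|F| ^ 2)%N%:R * (4 * e ^ 2 * #|F|)%N%:R :> int.
  by rewrite !natrM ?natrX; ring.
by rewrite ler_pM2l ?ltr0n ?muln_gt0 ?s0 ?expn_gt0 ?(ltnW q1) // ler_nat.
Qed.

(* [u] counts the points already chosen: each choice keeps at least the fraction
   [1 / e ^ 2] of every remaining candidate set. *)
Lemma exists_points_in_classes (m u : nat) (S : nat -> {set F}) (g : nat -> nat -> F) :
  (3 <= e)%N -> (forall i j, (i < j)%N -> g i j ^+ e = 1) ->
  (forall i, (i < m.+2)%N -> (#|F| <= e ^ (2 * u) * #|S i|)%N) ->
  (e ^ (4 * (m + u) + 2) < #|F|)%N ->
  exists b : nat -> F, (forall i, (i < m.+2)%N -> b i \in S i) /\
    (forall i j, (i < j)%N -> (j < m.+2)%N -> (b j - b i) ^+ f = g i j).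
Proof.
move=> e3; elim: m u S g => [|m IH] u S g ge Sbig big.
  have [||x [y [xS yS xy]]] := @exists_pair_in_class (S 0%N) (S 1%N) (g 0%N 1%N).
  - exact: ge.
  - have := leq_mul (Sbig 0%N isT) (Sbig 1%N isT).
    have eu : (0 < e ^ (2 * u))%N by rewrite expn_gt0 e_gt0.
    have q0 := ltnW q1.
    have -> : (e ^ (2 * u) * #|S 0%N| * (e ^ (2 * u) * #|S 1%N|) =
      e ^ (4 * u) * (#|S 0%N| * #|S 1%N|))%N.
      by rewrite mulnACA -expnD; congr (e ^ _ * _)%N; lia.
    move=> H; rewrite -(ltn_pmul2l (m := e ^ (4 * u))) ?expn_gt0 ?e_gt0 //.
    apply: leq_trans H; rewrite mulnCA ltn_pmul2l // -expnD.
    by rewrite add0n in big.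
  - exists (fun i => if i is 0%N then x else y); split.
      by case=> [|[|]].
    by case=> [|i] [|[|j]].
(* [z] is bad for [j] if taking it as point 0 would leave fewer than [#|S j| / e ^ 2] candidates for
   point [j]. Some point of [S 0] is bad for no later [j]. *)
pose bad j := [set z : F | (e ^ 2 * translate_count (S j) (g 0%N j) z < #|S j|)%N].
have q6 : (6 <= #|F|)%N.
  apply: leq_trans big; apply: (@leq_trans (3 ^ 2)%N) => //.
  apply: leqW; apply: (@leq_trans (e ^ 2)%N); first by rewrite leq_exp2r.
  by rewrite leq_exp2l ?leq_addl // (leq_trans _ e3).
have cbad (j : 'I_m.+2) : (#|bad j.+1| <= 4 * e ^ (2 * u + 2))%N.
  have := card_poor_translates (S j.+1) (ge 0%N j.+1 isT) e3 q6.
  rewrite -/(bad j.+1) => H.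
  have := leq_mul (leqnn #|bad j.+1|) (Sbig j.+1 (ltn_ord j)).
  move=> H1; rewrite -(leq_pmul2r (m := #|F|)) ?(ltnW q1) //.
  apply: (leq_trans H1); rewrite mulnCA.
  apply: leq_trans (leq_mul (leqnn _) H) _.
  by rewrite expnD; apply/eq_leq; ring.
have : (#|\bigcup_(j < m.+2) bad j.+1| < #|S 0%N|)%N.
  have Hc : (#|\bigcup_(j < m.+2) bad j.+1| <= m.+2 * (4 * e ^ (2 * u + 2)))%N.
    apply: (@leq_trans (\sum_(j < m.+2) #|bad j.+1|)%N); last first.
      apply: leq_trans (leq_sum _ (fun j _ => cbad j)) _.
      by rewrite sum_nat_const card_ord.
    elim/big_rec2: _ => [|j n A _ H]; first by rewrite cards0.
    by apply: leq_trans (leq_card_setU _ _) _; rewrite leq_add2l.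
  rewrite -(ltn_pmul2l (m := e ^ (2 * u))) ?expn_gt0 ?e_gt0 //.
  apply: leq_trans (Sbig 0%N isT).
  apply: leq_ltn_trans big.
  apply: leq_trans (leq_mul (leqnn _) Hc) _.
  (* The union over [m.+2] bad sets costs this factor, which the part [4 * m.+1] of the exponent
     absorbs. *)
  have m3 : (m.+2 * 4 <= e ^ (4 * m.+1))%N.
    apply: (@leq_trans (3 ^ (4 * m.+1))%N); last by rewrite leq_exp2r.
    by elim: (m) => // n IHn; rewrite (mulnS 4 n.+1) expnD (_ : 3 ^ 4 = 81)%N //; lia.
  have -> : (e ^ (2 * u) * (m.+2 * (4 * e ^ (2 * u + 2))) =
    m.+2 * 4 * e ^ (4 * u + 2))%N.
    have -> : (4 * u + 2 = 2 * u + (2 * u + 2))%N by lia.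
    by rewrite !expnD; ring.
  have -> : (4 * (m.+1 + u) + 2 = 4 * m.+1 + (4 * u + 2))%N by lia.
  by rewrite (expnD e (4 * m.+1)) leq_mul2r m3 orbT.
rewrite ltnNge => /negP noS.
have [x xS xgood] : exists2 x, x \in S 0%N & x \notin \bigcup_(j < m.+2) bad j.+1.
  have [/subset_leq_card //|/subsetPn[x]] := boolP (S 0%N \subset \bigcup_(j < m.+2) bad j.+1).
  by exists x.
pose S' j := [set y in S j.+1 | (y - x) ^+ f == g 0%N j.+1].
(* [m] drops by one as [u] grows by one, so the exponent [4 * (m + u) + 2] is unchanged. *)
have [|||b [bS bg]] := IH u.+1 S' (fun i j => g i.+1 j.+1).
- by move=> i j ij; exact: ge.
- move=> i im; apply: leq_trans (Sbig i.+1 im) _.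
  have -> : (2 * u.+1 = 2 * u + 2)%N by lia.
  rewrite expnD -mulnA leq_mul2l; apply/orP; right.
  rewrite leqNgt; apply/negP => xb; case/negP: xgood.
  by apply/bigcupP; exists (Ordinal im); rewrite ?inE.
- by rewrite -(addSnnS m u).
exists (fun i => if i is i'.+1 then b i' else x); split.
  by case=> // i im; have := bS i im; rewrite inE => /andP[].
case=> [|i] [|j] // ij jm; last exact: bg.
by have := bS j jm; rewrite inE => /andP[_ /eqP].
Qed.
End CyclotomicVariance.

(** * A base block whose differences represent all cosets *)

Section DifferenceFamily.
Local Open Scope ring_scope.

Lemma has_primitive_root_dvd (F : finFieldType) (n : nat) :
  (n %| #|F|.-1)%N -> exists z : F, n.-primitive_root z.
Proof.
move=> nF; have q1 := finNzRing_gt1 F.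
have q0 : (0 < #|F|.-1)%N by rewrite -subn1 subn_gt0.
have /hasP[z _ zP] : has (#|F|.-1).-primitive_root (enum [set~ (0 : F)]).
  apply: has_prim_root; rewrite ?enum_uniq //.
    apply/allP => x; rewrite mem_enum !inE => x0.
    by apply/unity_rootP; exact: expf_card1.
  by rewrite -cardE cardsC1.
by exists (z ^+ (#|F|.-1 %/ n)); exact: dvdn_prim_root.
Qed.

(* [i + 'C(j, 2)] is the rank of the pair [i < j] in colexicographic order. *)
Lemma pair_index_lt (i j k : nat) : (i < j)%N -> (j < k)%N -> (i + 'C(j, 2) < 'C(k, 2))%N.
Proof.
move=> ij jk; apply: (@leq_trans 'C(j.+1, 2)); last exact: leq_bin2l.
by rewrite binS bin1 addnC ltn_add2l.
Qed.

Lemma pair_index_inj (i j i' j' : nat) : (i < j)%N -> (i' < j')%N ->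
  (i + 'C(j, 2) = i' + 'C(j', 2))%N -> i = i' /\ j = j'.
Proof.
move=> ij ij' E; have [jj|jj|jj] := ltngtP j j'.
- by have := pair_index_lt ij jj; rewrite E ltnNge leq_addl.
- by have := pair_index_lt ij' jj; rewrite -E ltnNge leq_addl.
- by move: E; rewrite jj => /addIn.
Qed.

(** Nonzero elements share a coset of the subgroup of order [t] iff their [t]-th powers agree, so
    the count 1 says that the differences of [B] represent each coset exactly once. *)
Lemma exists_difference_family (F : finFieldType) (k t : nat) :
  (3 <= k)%N -> odd t -> #|F|.-1 = (k * k.-1 * t)%N ->
  ('C(k, 2) ^ (k * k.-1) < #|F|)%N ->
  exists B : {set F}, #|B| = k /\ forall x : F, x != 0 ->
    #|[set bb in setX B B | x ^+ t == (bb.1 - bb.2) ^+ t]| = 1%N.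
Proof.
move=> k3 todd Fk big.
have kE : (k * k.-1 = 2 * 'C(k, 2))%N.
  by rewrite mul2n bin2 -[LHS]odd_double_half; case: (k) => // n; rewrite /= oddM /= andNb.
set e := 'C(k, 2) in big kE.
have fe : (2 * t * e)%N = #|F|.-1 by rewrite Fk kE; lia.
have e3 : (3 <= e)%N by rewrite /e -[X in (X <= _)%N]/('C(3, 2)) leq_bin2l.
have k2 : (k = k.-2.+2)%N by case: (k) k3 => [|[]].
have [w wP] : exists w : F, e.-primitive_root w.
  by apply: has_primitive_root_dvd; rewrite -fe dvdn_mull.
(* The order [q - 1] of a primitive root is even, so the characteristic is not 2. *)
have two_neq0 : (2%:R : F) != 0.
  have [z zP] := @has_primitive_root_dvd F _ (dvdnn _).
  by apply: (prim_root_dvd_eq0 zP); rewrite -fe -mulnA dvdn_mulr.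
have w0 : w != 0 by rewrite (prim_root_eq0 wP) -lt0n (leq_trans _ e3).
have t0 : (0 < t)%N by rewrite odd_gt0.
(* The even exponent [2 * t] ignores signs, so only the pairs [i < j] need a class, and they get
   distinct powers of [w]. All candidate sets start full, whence [u = 0]. *)
have [|||b [_ bw]] := @exists_points_in_classes F (2 * t) e fe k.-2 0 (fun _ => setT)
  (fun i j => w ^+ (i + 'C(j, 2))) e3.
- by move=> i j _; rewrite exprAC (prim_expr_order wP) expr1n.
- by move=> i _; rewrite muln0 mul1n cardsT.
(* [4 * (k - 2) + 2 <= k * (k - 1)] because [(k - 2) * (k - 3) >= 0]. *)
- apply: leq_ltn_trans big; rewrite leq_exp2l ?(leq_trans _ e3) //.
  by rewrite {2 3}k2 /=; nia.
rewrite -k2 in bw.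
have bE i j : (i < k)%N -> (j < k)%N -> i != j ->
    (b i - b j) ^+ (2 * t) = w ^+ (minn i j + 'C(maxn i j, 2)).
  move=> ik jk; case: (ltngtP i j) => // ij _; last exact: bw.
  by rewrite -bw // -opprB exprM sqrrN -exprM.
have b_inj i j : (i < k)%N -> (j < k)%N -> b i = b j -> i = j.
  move=> ik jk bij; apply/eqP; apply/negPn/negP => ij; have := bE _ _ ik jk ij.
  rewrite bij subrr expr0n muln_eq0 /= eqn0Ngt t0 /= => /esym/eqP.
  by rewrite expf_eq0 (negbTE w0) andbF.
have diff_inj i j i' j' : (i < k)%N -> (j < k)%N -> (i' < k)%N -> (j' < k)%N ->
    i != j -> i' != j' -> (b i - b j) ^+ t = (b i' - b j') ^+ t -> i = i' /\ j = j'.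
  move=> ik jk ik' jk' ij ij' E.
  have : (b i - b j) ^+ (2 * t) = (b i' - b j') ^+ (2 * t).
    by rewrite mulnC !exprM E.
  rewrite !bE // => /eqP; rewrite (eq_prim_root_expr wP) /e.
  have lt a c : (a < k)%N -> (c < k)%N -> a != c -> (minn a c < maxn a c)%N /\ (maxn a c < k)%N.
    by move=> ak ck; rewrite neq_ltn; lia.
  have [m1 M1] := lt _ _ ik jk ij; have [m2 M2] := lt _ _ ik' jk' ij'.
  rewrite !modn_small ?pair_index_lt // => /eqP /(pair_index_inj m1 m2)[mE ME].
  (* Equal ranks only determine the unordered pair. If the order is swapped, oddness of [t] turns
     [E] into [a = - a], and as 2 is invertible this forces [b i = b j]. *)
  have [//|[ij1 ji1]] : (i = i' /\ j = j') \/ (i = j' /\ j = i') by lia.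
  move: E; rewrite -ij1 -ji1 -[b j - b i]opprB exprNn -signr_odd todd expr1 mulN1r => /eqP.
  rewrite -subr_eq0 opprK -mulr2n -mulr_natl mulf_eq0 (negbTE two_neq0) /=.
  rewrite expf_eq0 t0 subr_eq0 => /eqP/(b_inj _ _ ik jk) E.
  by rewrite E eqxx in ij.
pose B := [set b i | i : 'I_k].
have BP x : x \in B -> exists2 i, (i < k)%N & x = b i.
  by case/imsetP => i _ ->; exists i.
have cB : #|B| = k.
  by rewrite card_imset ?card_ord // => i j /b_inj E; apply/val_inj/E.
exists B; split=> // x x0.
pose D := [set bb in setX B B | bb.1 != bb.2].
pose delta (bb : F * F) := (bb.1 - bb.2) ^+ t.
have injD : {in D &, injective delta}.
  move=> [x1 x2] [y1 y2]; rewrite !inE /= => /andP[/andP[/BP[i ik ->] /BP[j jk ->]] ij].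
  move=> /andP[/andP[/BP[i' ik' ->] /BP[j' jk' ->]] ij'].
  move/diff_inj; case=> // [||-> ->] //.
    by apply: contraNneq ij => ->.
  by apply: contraNneq ij' => ->.
have cD : #|D| = (k * k.-1)%N.
  have := cardsID [set bb : F * F | bb.1 == bb.2] (setX B B).
  rewrite cardsX cB.
  have -> : setX B B :\: [set bb | bb.1 == bb.2] = D.
    by apply/setP => bb; rewrite !inE andbC.
  have -> : setX B B :&: [set bb | bb.1 == bb.2] = [set (y, y) | y in B].
    apply/setP => -[y z]; rewrite !inE /=; apply/idP/imsetP.
      by case/andP=> /andP[yB _] /eqP <-; exists y.
    by case=> u uB [-> ->]; rewrite uB eqxx.
  rewrite card_imset => [|u v [] //]; rewrite cB; nia.
(* [delta] is injective and both sides have at least, resp. at most, [k (k - 1)] elements. *)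
have imD : delta @: D = [set z | z ^+ (k * k.-1) == 1].
  apply/eqP; rewrite eqEcard card_in_imset // cD card_unity_roots; last by rewrite kE; lia.
  rewrite andbT; apply/subsetP => z /imsetP[[y1 y2]]; rewrite !inE /= => /andP[_ y12] ->.
  by rewrite /delta /= -exprM mulnC -Fk expf_card1 ?subr_eq0.
have : x ^+ t \in delta @: D by rewrite imD inE -exprM mulnC -Fk expf_card1.
case/imsetP => bb bbD xE.
apply/eqP/cards1P; exists bb; apply/setP => cc; rewrite inE [RHS]inE.
apply/idP/eqP => [/andP[ccB /eqP E]|->]; last first.
  by move: bbD; rewrite inE xE => /andP[-> _] /=.
apply: injD => //; last by rewrite -xE E.
rewrite inE ccB /=; apply: contraNneq x0 => c12; move/eqP: E.
by rewrite c12 subrr expr0n eqn0Ngt t0 /= expf_eq0 t0.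
Qed.

End DifferenceFamily.

(** * The partial difference set of a block-regular Steiner system *)

Section BlockRegularDesign.
Local Open Scope group_scope.
Variables (T : finType) (G : {group {perm T}}) (B : {set T}).
Hypothesis B_gt1 : (1 < #|B|)%N.
(** Elements of [G] are counted rather than blocks, so this also makes distinct elements give
    distinct blocks. *)
Hypothesis G_design : forall x y : T, x != y ->
  #|[set h in G | (x \in h @: B) && (y \in h @: B)]| = 1%N.

Local Notation r := ((#|T|.-1) %/ (#|B|.-1)).

Lemma card_perm_imset (h : {perm T}) : #|h @: B| = #|B|.
Proof. exact: card_imset perm_inj. Qed.

(** Double counting of the pairs [(y, h)] with [y != x] and both points on the block of [h]. *)
Lemma replication (x : T) : (#|[set h in G | x \in h @: B]| * #|B|.-1 = #|T|.-1)%N.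
Proof.
transitivity (\sum_(y | y != x) #|[set h in G | (x \in h @: B) && (y \in h @: B)]|)%N.
  under eq_bigr => y _ do rewrite -sum1_card.
  rewrite (exchange_big_dep [in [set h in G | x \in h @: B]]) /=; last first.
    by move=> y h _; rewrite !inE => /and3P[-> ->].
  rewrite -sum_nat_const; apply: eq_bigr => h; rewrite !inE => /andP[hG xh].
  rewrite sum1_card -(card_perm_imset h) (cardsD1 x) xh /=; apply: eq_card => y.
  by rewrite !inE [in RHS]unfold_in inE hG xh.
rewrite -(cardC1 x) -sum1_card; apply: eq_bigr => y yx.
by apply: G_design; rewrite eq_sym.
Qed.

Lemma replicationE (x : T) : #|[set h in G | x \in h @: B]| = r.
Proof. by rewrite -(replication x) mulnK // -subn1 subn_gt0. Qed.

Lemma card_pencil (x y : T) :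
  #|[set h in G | (x \in h @: B) && (y \in h @: B)]| = (1 + (x == y) * r.-1)%N.
Proof.
have [<-|xy] := eqVneq x y; last by rewrite G_design.
have -> : [set h in G | (x \in h @: B) && (x \in h @: B)] = [set h in G | x \in h @: B].
  by apply/setP => h; rewrite !inE andbb.
have := replication x; rewrite replicationE mul1n add1n => rE.
rewrite prednK // lt0n; apply/eqP => r0; move: rE; rewrite r0 mul0n => E.
have := max_card B; lia.
Qed.

Lemma sum_card_meet (C : {set T}) :
  (\sum_(h in G) #|h @: B :&: C| = #|C| * r)%N.
Proof.
under eq_bigr => h _ do rewrite -sum1_card.
rewrite (exchange_big_dep [in C]) /=; last by move=> h x _; rewrite inE => /andP[].
rewrite -sum_nat_const; apply: eq_bigr => x xC.
rewrite -(replicationE x) sum1_card; apply: eq_card => h.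
by rewrite !inE [in LHS]unfold_in inE xC andbT.
Qed.

(** Both sides count triples [(h, x, y)] with [x] in [C] and [y] in [D] on the block of [h]: each
    pair occurs once, and [r.-1] more times if [x = y]. *)
Lemma sum_card_meet2 (C D : {set T}) :
  (\sum_(h in G) #|h @: B :&: C| * #|h @: B :&: D| =
   #|C| * #|D| + #|C :&: D| * r.-1)%N.
Proof.
transitivity (\sum_(x in C) \sum_(y in D)
   #|[set h in G | (x \in h @: B) && (y \in h @: B)]|)%N.
  transitivity (\sum_(h in G) \sum_(x in C) \sum_(y in D)
      ((x \in h @: B) && (y \in h @: B)))%N.
    apply: eq_bigr => h _.
    have ind (E : {set T}) : (#|h @: B :&: E| = \sum_(x in E) (x \in h @: B))%N.
      rewrite -sum1_card big_mkcond [RHS]big_mkcond /=; apply: eq_bigr => x _.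
      by rewrite inE andbC; case: (x \in E); case: (x \in h @: B).
    rewrite !ind big_distrlr /=; apply: eq_bigr => x _; apply: eq_bigr => y _.
    by rewrite mulnb.
  rewrite exchange_big /=; apply: eq_bigr => x _.
  rewrite exchange_big /=; apply: eq_bigr => y _.
  rewrite -sum1_card big_mkcond [RHS]big_mkcond /=; apply: eq_bigr => h _.
  by rewrite !inE; case: (h \in G); case: (x \in _); case: (y \in _).
under eq_bigr => x _ do under eq_bigr => y _ do rewrite card_pencil.
under eq_bigr => x _ do rewrite big_split /= sum1_card -big_distrl /=.
rewrite big_split /= sum_nat_const -big_distrl /=; congr (_ + _ * _)%N.
rewrite -sum1_card [RHS]big_mkcond [LHS]big_mkcond /=; apply: eq_bigr => x _.
rewrite inE; case: (x \in C) => //=.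
case: ifP => xD; last first.
  rewrite big1 // => y yD; case: eqP => // xy; by rewrite xy yD in xD.
rewrite (bigD1 x) //= eqxx big1 // => y /andP[_]; by rewrite eq_sym => /negbTE->.
Qed.

Lemma card_meet_le1 (g h : {perm T}) : g \in G -> h \in G -> g != h ->
  (#|g @: B :&: h @: B| <= 1)%N.
Proof.
move=> gG hG; apply: contraR; rewrite -ltnNge => /card_gt1P[x [y [xB yB xy]]].
move: xB yB; rewrite !inE => /andP[xg xh] /andP[yg yh].
have /eqP/cards1P[u /setP U] := G_design xy.
move: (U g) (U h); rewrite !inE gG hG xg xh yg yh /= => /esym/eqP-> /esym/eqP->.
exact: eqxx.
Qed.

Lemma imset_perm1 : (1 : {perm T}) @: B = B.
Proof. by rewrite -[RHS]imset_id; apply: eq_imset => x; rewrite perm1. Qed.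

Lemma imset_permM (g h : {perm T}) (C : {set T}) : (g * h) @: C = h @: (g @: C).
Proof. by rewrite -imset_comp; apply: eq_imset => x /=; rewrite permM. Qed.

Definition meeting_set : {set {perm T}} :=
  [set g in G | (g != 1) && (g @: B :&: B != set0)].

Lemma meet_permV (h : {perm T}) (C : {set T}) :
  (h @: C :&: B != set0) = (h^-1 @: B :&: C != set0).
Proof.
apply/set0Pn/set0Pn => -[x]; rewrite inE => /andP[/imsetP[y yC ->] xB].
  by exists y; rewrite inE yC andbT; apply/imsetP; exists (h y); rewrite ?permK.
exists y; rewrite inE yC andbT; apply/imsetP; exists (h^-1 y); by rewrite ?permKV.
Qed.

Lemma card_GE : (#|G| * (#|B| * #|B|.-1) = #|T| * #|T|.-1)%N.
Proof.
have := sum_card_meet setT.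
under eq_bigr => h _ do rewrite setIT card_perm_imset.
rewrite sum_nat_const cardsT mulnA => ->.
have /card_gt0P[x _] := leq_trans (ltnW B_gt1) (max_card B).
by rewrite -mulnA -(replicationE x) replication.
Qed.

(** In [sum_card_meet] with [C = B] the term [h = 1] is [#|B|]; every other term is 0 or 1 and
    indicates membership. *)
Lemma card_meeting_set : (#|meeting_set| + #|B| = #|B| * r)%N.
Proof.
rewrite -(sum_card_meet B) (bigD1 1) //= imset_perm1 setIid addnC; congr (_ + _)%N.
rewrite -sum1_card [LHS]big_mkcond [RHS]big_mkcond /=; apply: eq_bigr => g _.
rewrite !inE; case gG: (g \in G) => //=; case g1: (g != 1) => //=.
have := card_meet_le1 gG (group1 G) g1; rewrite imset_perm1 -card_gt0.
by case: #|_| => [|[]].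
Qed.

Lemma meeting_setV : meeting_set^-1 = meeting_set.
Proof. by apply/setP => g; rewrite !inE groupV invg_eq1 meet_permV invgK. Qed.

Lemma card_meeting_set_quotients (g : {perm T}) : g \in G -> g != 1 ->
  (#|[set xy in setX meeting_set meeting_set | (xy.1 * xy.2^-1)%g == g]|
   + 2 * #|B| * (g \in meeting_set) = #|B| ^ 2 + (g \in meeting_set) * r.-1)%N.
Proof.
move=> gG g1.
have meetg : (#|B :&: g @: B| = (g \in meeting_set))%N.
  rewrite inE gG g1 setIC /=.
  have := card_meet_le1 gG (group1 G) g1; rewrite imset_perm1 -card_gt0.
  by case: #|_| => [|[]]. 
set N := #|[set xy in _ | _]|.
have -> : N = (\sum_(h in G | (h != 1%g) && (h != g)) #|h @: B :&: B| * #|h @: B :&: g @: B|)%N.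
  (* A representation [x * y^-1 = g] is indexed by [h = y^-1]. Then [y] is in the set iff [h != 1]
     and [h @: B] meets [B], and [x = g * h^-1] is iff [h != g] and [h @: B] meets [g @: B]. *)
  pose f (h : {perm T}) := (g * h^-1, h^-1).
  have injf : injective f by move=> h1 h2 [_ /invg_inj].
  rewrite /N (_ : [set xy in _ | _] = f @: [set h in G |
    [&& h != 1, h != g, h @: B :&: B != set0 & h @: B :&: g @: B != set0]]); last first.
    apply/setP => -[x y]; rewrite !inE /=; apply/idP/imsetP.
      case/andP=> /andP[/and3P[xG x1 xB] /and3P[yG y1 yB]] /eqP xyg.
      exists y^-1; last by rewrite /f invgK -xyg mulgKV.
      rewrite inE groupV yG invg_eq1 y1 -meet_permV yB /=.
      rewrite -meet_permV -imset_permM -xyg mulgKV xB andbT.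
      by rewrite eq_sym eq_mulgV1 invgK mulgKV.
    case=> h; rewrite inE => /and5P[hG h1 hg hB hgB] [-> ->].
    rewrite invgK mulgKV eqxx andbT groupM ?groupV // hG invg_eq1 h1.
    rewrite -eq_mulgV1 eq_sym hg imset_permM (meet_permV _ (g @: B)) (meet_permV _ B) invgK hgB /=.
    by rewrite hB.
  rewrite card_imset // -sum1_card big_mkcond [RHS]big_mkcond /=.
  apply: eq_bigr => h _; rewrite !inE.
  case hG: (h \in G) => //=; case h1: (h != 1) => //=; case hg: (h != g) => //=.
  have := card_meet_le1 hG (group1 G) h1; rewrite imset_perm1.
  have := card_meet_le1 hG gG hg; rewrite -!card_gt0.
  by do 2![case: #|_| => [|[]]] => //.
have := sum_card_meet2 B (g @: B).
(* The terms [h = 1] and [h = g] are each [#|B| * #|B :&: g @: B|]; together they give the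
   correction [2 * #|B|] for [g] in the set. *)
rewrite (bigD1 1) //= (bigD1 g) ?gG //= imset_perm1 !setIid card_perm_imset.
rewrite [g @: B :&: B]setIC meetg -mulnn => <-.
rewrite [RHS]addnA [RHS]addnC; congr (_ + _)%N; last by rewrite mulnC; lia.
by apply: eq_bigl => h; rewrite andbA.
Qed.

Lemma meeting_set_regular_PDS :
  is_regular_PDS G meeting_set
    ((#|T| * #|T|.-1) %/ (#|B| * #|B|.-1)) (#|B| * (#|T| - #|B|) %/ #|B|.-1)
    (r + #|B|.-1 ^ 2 - 2) (#|B| ^ 2).
Proof.
have B1_gt0 : (0 < #|B|.-1)%N by rewrite -subn1 subn_gt0.
have /card_gt0P[x0 _] := leq_trans (ltnW B_gt1) (max_card B).
have rE : (r * #|B|.-1 = #|T|.-1)%N by rewrite -(replicationE x0) replication.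
have r_gt0 : (0 < r)%N by have := card_pencil x0 x0; rewrite divn_gt0 //; have := max_card B; lia.
split; [split | exact: meeting_setV | by rewrite !inE eqxx andbF].
- by apply/subsetP => g; rewrite inE => /andP[].
- by rewrite -card_GE mulnK // muln_gt0 ltnW.
- have -> : (#|B| * (#|T| - #|B|) = #|meeting_set| * #|B|.-1)%N.
    have := congr1 (muln^~ #|B|.-1) card_meeting_set; have := max_card B.
    by rewrite mulnDl -mulnA rE mulnBr -!subn1 !mulnBr; lia.
  by rewrite mulnK.
- move=> g gG g1; have := card_meeting_set_quotients gG g1.
  case: (g \in _); rewrite ?mul1n ?mul0n ?muln1 ?muln0 ?addn0 // => E.
  (* With [k = #|B|], the count is [k ^ 2 + (r - 1) - 2 * k = r + (k - 1) ^ 2 - 2]. *)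
  have : (#|B| ^ 2 = #|B|.-1 ^ 2 + 2 * #|B| - 1)%N by rewrite -!mulnn; nia.
  move=> B2; apply: (@addIn (2 * #|B|)%N); rewrite [LHS]E B2; lia.
Qed.

End BlockRegularDesign.

(** * The affine group acting on the images of a base block *)

Section AffineDesign.
Local Open Scope ring_scope.
Variable F : finFieldType.
Implicit Types (u v : {unit F}) (c : F).

Lemma unit_val_neq0 u : val u != 0.
Proof. by rewrite -unitfE (valP u). Qed.

Lemma affine_fun_inj u c : injective (fun x : F => val u * x + c).
Proof. by move=> x y /addIr; apply: mulfI; exact: unit_val_neq0. Qed.

Definition affine_perm u c : {perm F} := perm (@affine_fun_inj u c).

Lemma affine_permE u c x : affine_perm u c x = val u * x + c.
Proof. exact: permE. Qed.

Lemma affine_groupP (H0 : {set {unit F}}) (s : {perm F}) :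
  reflect (exists u c, u \in H0 /\ s = affine_perm u c) (s \in affine_group H0).
Proof.
rewrite inE; apply: (iffP exists_inP).
  move=> [u uH /existsP[c /forallP sE]]; exists u, c; split=> //.
  by apply/permP => x; rewrite affine_permE; apply/eqP.
move=> [u [c [uH ->]]]; exists u => //; apply/existsP; exists c.
by apply/forallP => x; rewrite affine_permE.
Qed.

Lemma affine_group_set (H0 : {group {unit F}}) : group_set (affine_group H0).
Proof.
apply/group_setP; split.
  apply/affine_groupP; exists 1%g, 0; split; first exact: group1.
  by apply/permP => x; rewrite perm1 affine_permE mul1r addr0.
move=> s s' /affine_groupP[u [c [uH ->]]] /affine_groupP[u' [c' [uH' ->]]].
apply/affine_groupP; exists (u' * u)%g, (val u' * c + c'); split; first exact: groupM.
by apply/permP => x; rewrite permM !affine_permE /= mulrDr mulrA addrA.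
Qed.

(** The elements of [H0] are already [#|H0|] roots of [X ^ #|H0| - 1], hence all of them. *)
Lemma mem_unit_subgroup (H0 : {group {unit F}}) (z : F) :
  z ^+ #|H0| = 1 -> exists2 u, u \in H0 & val u = z.
Proof.
move=> zH; suff E : [set val u | u in H0] = [set x : F | x ^+ #|H0| == 1].
  have : z \in [set val u | u in H0] by rewrite E inE zH.
  by case/imsetP => u uH ->; exists u.
apply/eqP; rewrite eqEcard card_imset; last exact: val_inj.
rewrite card_unity_roots ?cardG_gt0 // andbT.
by apply/subsetP => _ /imsetP[u uH ->]; rewrite inE -FinRing.val_unitX expg_cardG.
Qed.

Lemma unit_subgroup_expr (H0 : {group {unit F}}) u : u \in H0 -> val u ^+ #|H0| = 1.
Proof. by move=> uH; rewrite -FinRing.val_unitX expg_cardG. Qed.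

(** An affine map with slope [u] sends [b1], [b2] to [x], [y] iff [u * (b1 - b2) = x - y] and its
    constant is [x - u * b1]. Only one pair of [B] allows [u] in [H0], and it determines the map. *)
Lemma affine_group_design (H0 : {group {unit F}}) (B : {set F}) :
  (forall x : F, x != 0 ->
    #|[set bb in setX B B | x ^+ #|H0| == (bb.1 - bb.2) ^+ #|H0|]| = 1%N) ->
  forall x y : F, x != y ->
    #|[set h in affine_group H0 | (x \in h @: B) && (y \in h @: B)]| = 1%N.
Proof.
move=> Bdiff x y xy.
have xy0 : x - y != 0 by rewrite subr_eq0.
have /eqP/cards1P[[b1 b2] /setP U] := Bdiff _ xy0.
have := U (b1, b2); rewrite !inE /= eqxx => /andP[/andP[b1B b2B] /eqP E].
have b12 : b1 - b2 != 0.
  apply: contraNneq xy0 => b0; move/eqP: E; rewrite b0 expr0n eqn0Ngt cardG_gt0 /=.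
  by rewrite expf_eq0 cardG_gt0.
have [u uH uE] : exists2 u, u \in H0 & val u = (x - y) / (b1 - b2).
  by apply: mem_unit_subgroup; rewrite expr_div_n E divff // expf_neq0.
have uxy : x - y = val u * (b1 - b2) by rewrite uE divfK.
apply/eqP/cards1P; exists (affine_perm u (x - val u * b1)).
apply/setP => h; rewrite inE [RHS]inE; apply/idP/eqP.
  case/and3P=> /affine_groupP[v [c [vH ->]]] /imsetP[b1' b1B' xE] /imsetP[b2' b2B' yE].
  rewrite !affine_permE in xE yE.
  have xyE : x - y = val v * (b1' - b2') by rewrite xE yE; ring.
  have := U (b1', b2'); rewrite !inE /= b1B' b2B' xyE exprMn unit_subgroup_expr //.
  rewrite mul1r eqxx => /esym/eqP[b1E b2E].
  have uv : val v = val u.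
    by apply: (mulIf b12); rewrite -uxy xyE b1E b2E.
  apply/permP => z; rewrite !affine_permE uv; congr (_ + _).
  by rewrite xE uv b1E addrC addKr.
move=> ->; apply/and3P; split.
- by apply/affine_groupP; exists u, (x - val u * b1).
- by apply/imsetP; exists b1; rewrite ?affine_permE ?subrKC //; ring.
- apply/imsetP; exists b2; rewrite ?affine_permE //.
  by rewrite -[LHS](subKr x) uxy; ring.
Qed.

End AffineDesign.

(** * Specialisation to the stated parameters *)

Theorem mainTheorem19 (k p d : nat) (F : finFieldType) (H0 : {group {unit F}}) :
  3 <= k -> prime p -> 1 <= d ->
  #|F| = p ^ d ->
  ((k * (k - 1))./2) ^ (k * (k - 1)) < p ^ d ->
  p ^ d = k * (k - 1) + 1 %[mod 2 * (k * (k - 1))] ->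
  #|H0| = (p ^ d - 1) %/ (k * (k - 1)) ->
  exists D : {set {perm F}},
    is_regular_PDS (affine_group H0) D
      ((p ^ d * (p ^ d - 1)) %/ (k * (k - 1)))
      ((k * (p ^ d - k)) %/ (k - 1))
      ((p ^ d - 1) %/ (k - 1) + (k - 1) ^ 2 - 2)
      (k ^ 2).
Proof.
move=> k3 _ _ <-; rewrite !subn1 => big cong H0E.
set K := k * k.-1 in big cong H0E.
have K6 : 6 <= K by rewrite /K; case: k k3 {big cong H0E K} => [|[|[|n]]] //= _; nia.
(* The remainder of [#|F|] modulo [2 * K] is [K + 1], as [K + 1 < 2 * K]; hence the cofactor of [K]
   in [#|F|.-1] is odd. *)
have qE : #|F|.-1 = K * (#|F| %/ (2 * K)).*2.+1.
  have := divn_eq #|F| (2 * K); rewrite cong modn_small; last lia.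
  move: (#|F| %/ (2 * K)) => n ->; rewrite -mul2n; nia.
have tE : #|H0| = (#|F| %/ (2 * K)).*2.+1 by rewrite H0E qE mulKn //; lia.
have [|||B [cB Bdiff]] := @exists_difference_family F k #|H0| k3.
- by rewrite tE /= odd_double.
- by rewrite qE tE.
- by rewrite bin2.
exists (meeting_set (Group (affine_group_set H0)) B); rewrite -cB.
apply: (@meeting_set_regular_PDS _ (Group (affine_group_set H0)) B).
  by rewrite cB (leq_trans _ k3).
exact: affine_group_design.
Qed.
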